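(* Let $n \geq 2$. There does not exist a norm on $\mathbb{C}^n$ which is simultaneously a complex polytope norm and an adjoint complex polytope norm.
   Context: For vectors $u_1,\dots,u_N\in\mathbb{C}^n$ put $\operatorname{absconv}\{u_1,\dots,u_N\}=\{\alpha_1u_1+\dots+\alpha_Nu_N:\ \alpha_j\in\mathbb{C},\ \sum_{j=1}^N|\alpha_j|\le 1\}$. A norm on $\mathbb{C}^n$ is a complex polytope norm if its closed unit ball equals $\operatorname{absconv}\{u_1,\dots,u_N\}$ for some finite set of vectors $u_1,\dots,u_N\in\mathbb{C}^n$. A norm on $\mathbb{C}^n$ is an adjoint complex polytope norm if it is the dual norm of a complex polytope norm; equivalently, there are finitely many linear functionals $f_1,\dots,f_N:\mathbb{C}^n\to\mathbb{C}$ such that $\|x\|=\max_{1\le j\le N}|f_j(x)|$ for every $x\in\mathbb{C}^n$. *)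

(* Defs.v *)
From mathcomp Require Import all_boot all_order all_algebra.
From mathcomp Require Import complex.
From mathcomp Require Import all_classical all_reals.

Set Implicit Arguments.
Unset Strict Implicit.
Unset Printing Implicit Defensive.

Import Order.TTheory GRing.Theory Num.Theory.
Import ComplexField.Normc.

Local Open Scope classical_set_scope.
Local Open Scope ring_scope.
Local Open Scope complex_scope.

(* [normc : R[i] -> R] is the modulus with values in the reals; the generic
   [`|z|] of MathComp on [R[i]] takes its values in [R[i]]. *)

Record is_norm (R : realType) (n : nat) (N : 'rV[R[i]]_n -> R) : Prop := IsNorm {
  norm_triangle : forall x y, N (x + y) <= N x + N y ;
  norm_homogeneous : forall (a : R[i]) x, N (a *: x) = normc a * N x ;
  norm_definite : forall x, N x = 0 -> x = 0
}.

Definition unit_ball (R : realType) (n : nat) (N : 'rV[R[i]]_n -> R)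
  : set 'rV[R[i]]_n := [set x | N x <= 1].

Definition absconv (R : realType) (n m : nat) (u : 'I_m -> 'rV[R[i]]_n)
  : set 'rV[R[i]]_n :=
  [set x | exists2 a : 'I_m -> R[i],
     \sum_(j < m) normc (a j) <= 1 & x = \sum_(j < m) a j *: u j].

Definition complex_polytope_norm (R : realType) (n : nat)
    (N : 'rV[R[i]]_n -> R) : Prop :=
  is_norm N /\
  exists (m : nat) (u : 'I_m -> 'rV[R[i]]_n), unit_ball N = absconv u.

(* The dual space of C^n is identified with C^n through the standard Hermitian
   product [dotmx x y = \sum_i x_i * (y_i)^*]. When [N] is a norm, the supremum
   is over a nonempty bounded set, so the default value of [sup] is not used. *)
Definition dual_norm (R : realType) (n : nat) (N : 'rV[R[i]]_n -> R)
    (x : 'rV[R[i]]_n) : R :=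
  sup [set normc (dotmx x y) | y in unit_ball N].

Definition adjoint_complex_polytope_norm (R : realType) (n : nat)
    (N : 'rV[R[i]]_n -> R) : Prop :=
  exists2 M : 'rV[R[i]]_n -> R, complex_polytope_norm M & N = dual_norm M.

(* Main.v *)
Require Import Defs.
From mathcomp Require Import all_boot all_order all_algebra.
From mathcomp Require Import complex.
From mathcomp Require Import all_classical all_reals.
From mathcomp Require Import ring lra.

(* Suppose that N = max_j |f_j| and that the unit ball of N is
   absconv {u_1, ..., u_m}.  If two functionals f and g both norm x, equality
   in the triangle inequality forces g(x) / f(x) = g(u_k) / f(u_k) for some k,
   so this ratio takes finitely many values.  Discard redundant functionals;
   then some f_i strictly dominates all the others at a point x0.  As n >= 2
   there is y <> 0 with f_i(y) = 0, and |f_i| is constant on the complex line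
   x0 + z y.  Along each real ray of this line starting at x0, some other f_j
   eventually grows and first reaches the level |f_i(x0)|, where f_i and f_j
   both norm the point.  The ratio f_j / f_i determines z there, so infinitely
   many directions contradict the finiteness of the set of ratios. *)

Set Implicit Arguments.
Unset Strict Implicit.
Unset Printing Implicit Defensive.

Import Order.TTheory GRing.Theory Num.Theory.
Import ComplexField.Normc.

Local Open Scope ring_scope.
Local Open Scope complex_scope.

(** * Complex moduli: discs, rays, equality in the triangle inequality *)

Section Modulus.
Variable R : rcfType.
Implicit Types (p d z : R[i]) (a c t : R).

Lemma normcR_ge0 z : 0 <= normc z.
Proof. by case: z => a b; exact: sqrtr_ge0. Qed.

Lemma normcR_gt0 z : (0 < normc z) = (z != 0).
Proof.
rewrite lt_def normcR_ge0 andbT; apply/idP/idP; apply: contra => /eqP.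
  by move->; rewrite normc0.
by move/eq0_normc->.
Qed.

Lemma normc_real a : normc a%:C = `|a|.
Proof. by rewrite /normc /= expr0n addr0 sqrtr_sqr. Qed.

Lemma normc_conj z : normc (Num.conj z) = normc z.
Proof. exact: complexI (norm_conjC z). Qed.

Lemma normc_sum (I : finType) (F : I -> R[i]) :
  normc (\sum_i F i) <= \sum_i normc (F i).
Proof.
elim/big_rec2: _ => [|i x y _ le_yx]; first by rewrite normc0.
by apply: le_trans (le_normcD _ _) _; rewrite lerD2l.
Qed.

(** Discs are convex, and [p + s d] lies on the segment from [p] to [p + t d]. *)
Lemma segment_normc_le p d t s c :
  normc p <= c -> normc (p + t%:C * d) <= c -> 0 <= s <= t ->
  normc (p + s%:C * d) <= c.
Proof.
move=> le_p le_t /andP[s_ge0 le_st].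
have [t_eq0|t_neq0] := eqVneq t 0.
  have -> : s = 0 by apply/le_anti; rewrite s_ge0 -{1}t_eq0 le_st.
  by rewrite mul0r addr0.
have t_gt0 : 0 < t by rewrite lt_def t_neq0 (le_trans s_ge0).
pose l := s / t.
have l_ge0 : 0 <= l by rewrite divr_ge0 // ltW.
have l_le1 : l <= 1 by rewrite ler_pdivrMr // mul1r.
have -> : p + s%:C * d = (1 - l)%:C * p + l%:C * (p + t%:C * d).
  have -> : s%:C = l%:C * t%:C by rewrite -rmorphM /= divfK.
  by rewrite rmorphB rmorph1; ring.
apply: le_trans (le_normcD _ _) _; rewrite !normcM !normc_real.
rewrite !ger0_norm ?subr_ge0 //.
have -> : c = (1 - l) * c + l * c by ring.
by apply: lerD; apply: ler_wpM2l; rewrite ?subr_ge0.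
Qed.

(** The root [(D - B) / A] of [A t^2 + 2 B t + C = |p + t d|^2 - c^2] is positive, because [p] lies
    inside the disc and so [C < 0]. *)
Lemma ray_exits_disc p d c : normc p < c -> d != 0 ->
  exists2 t, 0 < t & normc (p + t%:C * d) = c.
Proof.
case: p d => [p1 p2] [d1 d2] lt_pc.
rewrite eq_complex negb_and /= => d_neq0.
have c_gt0 : 0 < c := le_lt_trans (normcR_ge0 _) lt_pc.
have {lt_pc} C_lt0 : p1 ^+ 2 + p2 ^+ 2 - c ^+ 2 < 0.
  rewrite subr_lt0 -(@sqr_sqrtr _ (p1 ^+ 2 + p2 ^+ 2)) ?addr_ge0 ?sqr_ge0 //.
  by rewrite ltr_pXn2r // ?nnegrE ?sqrtr_ge0 // ltW.
have A_gt0 : 0 < d1 ^+ 2 + d2 ^+ 2.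
  rewrite lt_def addr_ge0 ?sqr_ge0 // andbT paddr_eq0 ?sqr_ge0 //.
  by rewrite !sqrf_eq0 negb_and.
set A := d1 ^+ 2 + d2 ^+ 2 in A_gt0.
pose B := p1 * d1 + p2 * d2.
set C := _ - _ in C_lt0.
have D_ge0 : 0 <= B ^+ 2 - A * C.
  by rewrite addr_ge0 ?sqr_ge0 // -mulrN mulr_ge0 ?ltW // oppr_gt0.
pose D := Num.sqrt (B ^+ 2 - A * C).
have D2 : D ^+ 2 = B ^+ 2 - A * C by rewrite sqr_sqrtr.
have lt_BD : B < D.
  apply: le_lt_trans (ler_norm _) _; rewrite -sqrtr_sqr ltr_sqrt.
    by rewrite ltrDl -mulrN pmulr_rgt0 // oppr_gt0.
  rewrite -mulrN ltr_wpDl ?sqr_ge0 // pmulr_rgt0 //.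
  by rewrite oppr_gt0.
have A_neq0 : A != 0 by rewrite gt_eqF.
exists ((D - B) / A); first by rewrite divr_gt0 // subr_gt0.
have At : A * ((D - B) / A) = D - B by rewrite mulrC divfK.
set t := _ / A in At *.
rewrite /normc /= !mul0r !subr0 addr0.
have -> : (p1 + t * d1) ^+ 2 + (p2 + t * d2) ^+ 2 = c ^+ 2.
  apply: (mulfI A_neq0); apply/eqP; rewrite -subr_eq0; apply/eqP.
  transitivity ((A * t) ^+ 2 + (A * t) * B * 2%:R + A * C).
    by rewrite /A /B /C; ring.
  by rewrite At -(subKr (B ^+ 2) (A * C)) -D2; ring.
by rewrite sqrtr_sqr gtr0_norm.
Qed.

(** Equality holds throughout [1 = |w| <= \sum |a k z k| <= \sum |a k| <= 1]. The terms
    [a k z k / w] are bounded in modulus by [|a k|] and have the same sum as these bounds, so each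
    equals its bound. *)
Lemma sum_normc_extremal (I : finType) (a z : I -> R[i]) :
  \sum_k normc (a k) <= 1 -> (forall k, normc (z k) <= 1) ->
  normc (\sum_k a k * z k) = 1 ->
  forall k, a k * z k = (normc (a k))%:C * \sum_k a k * z k.
Proof.
move=> sum_a z_le1 norm1.
set w := \sum_k _ in norm1 *.
have w_neq0 : w != 0 by rewrite -normcR_gt0 norm1.
have le_az k : normc (a k * z k) <= normc (a k).
  by rewrite normcM ler_piMr ?normcR_ge0.
have sum1 : \sum_k normc (a k) = 1.
  apply/le_anti; rewrite sum_a -norm1.
  by apply: le_trans (normc_sum _) (ler_sum _ _).
have H := @normC_sum_upper R[i] I xpredT
  (fun k => a k * z k / w) (fun k => (normc (a k))%:C).
move=> k; rewrite -(H _ _ k) ?mulfVK //.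
- move=> j _; change ((normc (a j * z j / w))%:C <= (normc (a j))%:C).
  by rewrite lecR normcM normcV norm1 invr1 mulr1.
- rewrite -mulr_suml divff // -[RHS](rmorph_sum (real_complex R)).
  by rewrite sum1.
Qed.

End Modulus.

(** * Irredundant families and kernels of functionals *)

Lemma irredundant_subfamily (R : numDomainType) (T : Type) (I : finType)
    (g : I -> T -> R) (N : T -> R) (z : T) :
  (forall i x, g i x <= N x) -> (forall x, exists i, g i x = N x) ->
  exists (S : {set I}) (i : I) (x : T),
    [/\ i \in S, forall y, exists2 j, j \in S & g j y = N y
      & forall j, j \in S -> j != i -> g j x < N x].
Proof.
move=> le_gN max_g.
pose attains (S : {set I}) := `[< forall y, exists2 j, j \in S & g j y = N y >].
have [S /minsetP[/asboolP SP minS]] : {S | minset attains S}.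
  apply: ex_minset; exists [set: I]; apply/asboolP => y.
  by have [j <-] := max_g y; exists j.
have [i iS _] := SP z.
(* By minimality of [S], deleting [i] loses the value of [N] at some [x]. *)
have /asboolP/existsNP[x xP] : ~~ attains (S :\ i).
  apply/negP => /minS/(_ (subD1set _ _)) eqS.
  by move: iS; rewrite -eqS setD11.
exists S, i, x; split=> // j jS ji.
rewrite lt_neqAle le_gN andbT; apply/eqP => gx; apply: xP; exists j => //.
by rewrite !inE ji.
Qed.

Lemma exists_kernel_vector (K : fieldType) (n : nat) (f : {scalar 'rV[K]_n}) :
  (2 <= n)%N -> exists2 y, y != 0 & f y = 0.
Proof.
case: n f => [|[|n]] // f _.
pose e0 : 'rV[K]_n.+2 := delta_mx 0 0; pose e1 : 'rV[K]_n.+2 := delta_mx 0 1.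
have [f0|f0] := eqVneq (f e0) 0.
  exists e0 => //; apply/eqP => /rowP/(_ 0); rewrite !mxE /=.
  by move/eqP; rewrite oner_eq0.
exists (f e1 *: e0 - f e0 *: e1).
  apply/eqP => /rowP/(_ 1); rewrite !mxE /= mulr0 mulr1 sub0r => /eqP.
  by rewrite oppr_eq0 (negbTE f0).
by rewrite linearB !linearZ /= mulrC subrr.
Qed.

(** * Polytope norms and their duals *)

Section Polytopes.
Variables (R : realType) (n : nat) (N : 'rV[R[i]]_n -> R).
Hypothesis normN : is_norm N.

Lemma is_norm0 : N 0 = 0.
Proof. by rewrite -(scale0r 0) (norm_homogeneous normN) normc0 mul0r. Qed.

Lemma is_norm_ge0 x : 0 <= N x.
Proof.
have := norm_triangle normN x ((-1) *: x).
rewrite (norm_homogeneous normN) scaleN1r subrr is_norm0 normcN normc1 mul1r.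
by rewrite -mulr2n pmulrn_lge0.
Qed.

Lemma is_norm_gt0 x : x != 0 -> 0 < N x.
Proof.
move=> x_neq0; rewrite lt_def is_norm_ge0 andbT.
by apply: contra x_neq0 => /eqP/(norm_definite normN)->.
Qed.

Lemma absconv_generator (m : nat) (u : 'I_m -> 'rV[R[i]]_n) k :
  absconv u (u k).
Proof.
exists (fun j => (j == k)%:R).
  rewrite (bigD1 k) //= eqxx normc1 big1 ?addr0 // => j /negbTE->.
  exact: normc0.
rewrite (bigD1 k) //= eqxx scale1r big1 ?addr0 // => j /negbTE->.
exact: scale0r.
Qed.

(* The ratio [g x / f x] of two functionals norming [x] takes only finitely
   many values: equality in the triangle inequality forces [f] and [g] to norm
   every vertex that occurs in [x]. *)
Lemma norming_ratio (m : nat) (u : 'I_m -> 'rV[R[i]]_n)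
    (f g : {scalar 'rV[R[i]]_n}) (x : 'rV[R[i]]_n) :
  unit_ball N = absconv u ->
  (forall y, normc (f y) <= N y) -> (forall y, normc (g y) <= N y) ->
  0 < N x -> normc (f x) = N x -> normc (g x) = N x ->
  exists2 k, f (u k) != 0 & g x * f (u k) = f x * g (u k).
Proof.
move=> ballN le_fN le_gN Nx_gt0 fx gx.
pose w := (N x)^-1%:C *: x.
have Nw : N w = 1.
  rewrite (norm_homogeneous normN) normc_real ger0_norm ?invr_ge0 ?ltW //.
  by rewrite mulVf ?gt_eqF.
have [a sum_a w_def] : absconv u w by rewrite -ballN /unit_ball /= Nw.
have Nu k : N (u k) <= 1.
  by have := absconv_generator u k; rewrite -ballN.
have normw (h : {scalar 'rV[R[i]]_n}) : normc (h x) = N x -> normc (h w) = 1.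
  move=> hx; rewrite linearZ /= normcM hx normc_real.
  by rewrite ger0_norm ?invr_ge0 ?ltW // mulVf ?gt_eqF.
have vertices (h : {scalar 'rV[R[i]]_n}) :
    (forall y, normc (h y) <= N y) -> normc (h x) = N x ->
    forall k, a k * h (u k) = (normc (a k))%:C * ((N x)^-1%:C * h x).
  move=> le_hN hx k.
  have hw : h w = \sum_k a k * h (u k).
    by rewrite w_def linear_sum; apply: eq_bigr => j _; rewrite linearZ.
  have := @sum_normc_extremal _ _ a (fun j => h (u j)) sum_a _ _ k.
  rewrite -hw normw // /w linearZ /=; apply=> // j.
  exact: le_trans (le_hN _) (Nu j).
have fa := vertices f le_fN fx; have ga := vertices g le_gN gx.
have [k ak] : exists k, a k != 0.
  apply: contrapT => /forallNP a0; have w0 : w = 0.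
    rewrite w_def big1 // => j _; have /negP := a0 j.
    by rewrite negbK => /eqP->; rewrite scale0r.
  by have /eqP := Nw; rewrite w0 is_norm0 eq_sym oner_eq0.
have ak' : (normc (a k))%:C != 0 :> R[i].
  by rewrite -normcR_gt0 normc_real normr_gt0 gt_eqF // normcR_gt0.
exists k.
  have : a k * f (u k) != 0.
    rewrite fa mulf_neq0 // mulf_neq0 //; last by rewrite -normcR_gt0 fx.
    by rewrite -normcR_gt0 normc_real normr_gt0 invr_eq0 gt_eqF.
  by rewrite mulf_eq0 negb_or ak.
(* Both [a k * f (u k)] and [a k * g (u k)] are the same multiple, [|a k| / N x], of [f x] and
   [g x]. *)
apply: (mulfI ak); rewrite mulrCA fa [RHS]mulrCA ga; ring.
Qed.

(** A bound on all [|<x, v j>|] extends to the absolutely convex hull, so the supremum is reached at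
    a generator. *)
Lemma dual_norm_max (M : 'rV[R[i]]_n -> R) (p : nat)
    (v : 'I_p -> 'rV[R[i]]_n) x :
  (0 < n)%N -> unit_ball M = absconv v -> N = dual_norm M ->
  (forall j, normc (dotmx x (v j)) <= N x) /\
  exists j, normc (dotmx x (v j)) = N x.
Proof.
move=> n_gt0 ballM Ndual.
case: p v ballM => [|p] v ballM.
  (* Without generators the ball of [M] is [{0}] and its dual norm vanishes at [e != 0], which a
     norm cannot do. *)
  pose e : 'rV[R[i]]_n := const_mx 1.
  have : e != 0.
    apply/eqP => /rowP/(_ (Ordinal n_gt0)); rewrite !mxE.
    by move/eqP; rewrite oner_eq0.
  move/is_norm_gt0; rewrite Ndual /dual_norm ballM.
  suff -> : [set normc (dotmx e y) | y in absconv v]%classic = [set 0]%classic.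
    by rewrite sup1 ltxx.
  apply/seteqP; split=> [_ [y [a _ ->] <-]|_ ->].
    by rewrite big_ord0 linear0r normc0.
  exists 0; last by rewrite linear0r normc0.
  by exists (fun=> 0); rewrite !big_ord0.
pose F j := normc (dotmx x (v j)).
pose j0 := [arg max_(j > ord0) F j]%O.
have le_F j : F j <= F j0.
  by rewrite /j0; case: Order.TotalTheory.arg_maxP => // i _; apply.
suff NxE : N x = F j0 by rewrite NxE; split=> //; exists j0.
have Fub : ubound [set normc (dotmx x y) | y in unit_ball M]%classic (F j0).
  move=> _ [y + <-]; rewrite ballM => -[a sum_a ->].
  rewrite linear_sumr; apply: le_trans (normc_sum _) _.
  apply: (@le_trans _ _ (\sum_j normc (a j) * F j0)).
    apply: ler_sum => j _; rewrite linearZr_LR /= normcM.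
    by rewrite normc_conj; apply: ler_wpM2l (le_F j); exact: normcR_ge0.
  by rewrite -mulr_suml ler_piMl ?normcR_ge0.
have Fin : [set normc (dotmx x y) | y in unit_ball M]%classic (F j0).
  by exists (v j0) => //; rewrite ballM; exact: absconv_generator.
rewrite Ndual; apply/le_anti/andP; split.
  by apply: ge_sup => //; exists (F j0).
by apply: ub_le_sup => //; exists (F j0).
Qed.

Lemma absconv_not_max_functionals (m p : nat) (u : 'I_m -> 'rV[R[i]]_n)
    (f : 'I_p -> {scalar 'rV[R[i]]_n}) :
  (2 <= n)%N -> unit_ball N = absconv u ->
  (forall j x, normc (f j x) <= N x) ->
  (forall x, exists j, normc (f j x) = N x) -> False.
Proof.
move=> hn ballN le_fN max_f.
have [S [i [x0 [iS maxS ess]]]] := irredundant_subfamily 0 le_fN max_f.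
have [y y_neq0 fiy] := exists_kernel_vector (f i) hn.
set c := N x0 in ess.
have fix0 : normc (f i x0) = c.
  have [j jS fj] := maxS x0; have [<- //|ji] := eqVneq j i.
  by have := ess j jS ji; rewrite fj ltxx.
(* [z j k] is the only parameter at which [f j / f i], restricted to the line
   [x0 + z y], takes its value at the vertex [u k]; the direction [1 + s i] is
   steeper than every [z j k]. *)
pose z j k := (f i x0 * f j (u k) / f i (u k) - f j x0) / f j y.
pose slope j k := `|complex.Im (z j k) / complex.Re (z j k)|.
pose s : R := 1 + \sum_j \sum_k slope j k.
have slope_lt j k : slope j k < s.
  rewrite /s (bigD1 j) //= (bigD1 k) //=.
  have ge0 (P : pred 'I_m) h : 0 <= \sum_(l | P l) slope h l.
    by apply: sumr_ge0 => l _; exact: normr_ge0.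
  have := ge0 (fun l => l != k) j.
  have : 0 <= \sum_(h | h != j) \sum_l slope h l.
    by apply: sumr_ge0 => h _; exact: ge0.
  by move=> ? ?; lra.
pose e : R[i] := Complex 1 s.
have e_neq0 : e != 0 by rewrite eq_complex negb_and /= oner_eq0.
(* The members of [S] that vary along the line; [i] is not one of them. *)
pose T := [set j in S | f j y != 0].
have [j1 j1T] : exists j, j \in T.
  have [j jS fj] := maxS y; exists j.
  by rewrite inE jS /= -normcR_gt0 fj is_norm_gt0.
have ess_T j : j \in T -> normc (f j x0) < c.
  rewrite inE => /andP[jS fjy]; apply: ess => //.
  by apply: contra_neq fjy => ->.
have /choice[t tP] : forall j, exists t, j \in T ->
    0 < t /\ normc (f j x0 + t%:C * (e * f j y)) = c.
  move=> j; case: (boolP (j \in T)) => [jT|_]; last by exists 0.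
  have dy : e * f j y != 0.
    by rewrite mulf_neq0 //; move: jT; rewrite inE => /andP[].
  by have [t ? ?] := ray_exits_disc (ess_T j jT) dy; exists t.
(* Among the members of [T], [f j] reaches the level [c] first. *)
have [j jT t_min] : exists2 j, j \in T & forall h, h \in T -> t j <= t h.
  by case: (Order.TotalTheory.arg_minP t j1T) => j; exists j.
have [tj_gt0 fjx] := tP j jT.
pose x := x0 + ((t j)%:C * e) *: y.
have fxE h : f h x = f h x0 + (t j)%:C * (e * f h y).
  by rewrite linearD linearZ /= mulrA.
have fix_ : f i x = f i x0 by rewrite fxE fiy !mulr0 addr0.
(* Up to [t j], members of [T] stay in the disc of radius [c] by convexity and the rest of [S] is
   constant, while [|f i|] keeps the value [c]. *)
have Nx : N x = c.
  apply/le_anti; rewrite -[X in _ && (X <= _)]fix0 -fix_ le_fN andbT.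
  have [h hS <-] := maxS x; rewrite fxE.
  have [->|fhy] := eqVneq (f h y) 0; first by rewrite !mulr0 addr0 le_fN.
  have hT : h \in T by rewrite inE hS.
  have [_ fh] := tP h hT.
  apply: (segment_normc_le (t := t h)); first exact: le_fN.
    by rewrite fh.
  by rewrite (ltW tj_gt0) t_min.
have c_gt0 : 0 < c := le_lt_trans (normcR_ge0 _) (ess_T j jT).
have [] := @norming_ratio _ u (f i) (f j) x ballN (le_fN i) (le_fN j).
- by rewrite Nx.
- by rewrite fix_ Nx.
- by rewrite fxE Nx fjx.
move=> k fuk ratio.
(* Here the divisors in [z j k] are nonzero, so equality of the ratios recovers the parameter of
   [x], whose slope is [s]. *)
have zE : z j k = (t j)%:C * e.
  have fjy : f j y != 0 by move: jT; rewrite inE => /andP[].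
  apply: (mulIf fjy); rewrite /z divfK // -fix_ -ratio mulfK // fxE.
  by rewrite addrC addKr mulrA.
have := slope_lt j k; rewrite /slope zE /= !mul0r !mulr1 subr0 addr0.
by rewrite mulrC mulKf ?gt_eqF // ltNge ler_norm.
Qed.

End Polytopes.

Theorem theorem2p3 (R : realType) (n : nat) (hn : (2 <= n)%N) :
  ~ exists N : 'rV[R[i]]_n -> R,
      [/\ is_norm N, complex_polytope_norm N
        & adjoint_complex_polytope_norm N].
Proof.
move=> [N [normN [_ [m [u ballN]]] [M [_ [p [v ballM]]] Ndual]]].
have attained x := dual_norm_max normN x (ltnW hn) ballM Ndual.
(* [dotmx] is linear in its first argument, so the vertex goes in the second. *)
apply: (absconv_not_max_functionals normN
  (f := fun j => applyr (@dotmx _ n) (v j)) hn ballN).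
- by move=> j x; exact: (attained x).1.
- by move=> x; exact: (attained x).2.
Qed.
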